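(* Let $n\ge 1$ and let $\mathbf{C}=(C_1,\dots,C_n)$ be an arrangement of full-rank $(h+1)\times(N+1)$ complex matrices, with associated point multiview variety $\mathcal{M}_{\mathbf{C}}^{N,h}\subseteq(\mathbb{P}^h)^n$. (P1) Let $N\ge 0$ be a natural number and $h=N$. Then $$\mathcal{M}_{\mathbf{C}}^{N,N}=\{x\in(\mathbb{P}^N)^n : \mathrm{rank}\begin{bmatrix}C_1^{-1}x_1&\cdots&C_n^{-1}x_n\end{bmatrix}\le 1\}.$$ (P2) Let $N\ge 1$ be a natural number and $h=N-1$. Then $$\mathcal{M}_{\mathbf{C}}^{N,N-1}=\{x\in(\mathbb{P}^{N-1})^n : \mathrm{rank}\, M_{\mathbf{C}}(x)\le N+n\}$$ if and only if the centers of $\mathbf{C}$ are pairwise distinct. (P3) Let $N\ge 0$ be a natural number and $h=1$. Then $$\mathcal{M}_{\mathbf{C}}^{N,1}=\{x\in(\mathbb{P}^1)^n : \mathrm{rank}\begin{bmatrix}C_1^T\widetilde{x}_1&\cdots&C_n^T\widetilde{x}_n\end{bmatrix}\le N\}$$ if and only if for each nonempty $I\subseteq\{1,\dots,n\}$ with $c_I\neq\emptyset$ we have $N-|I|-1\ge\dim c_I$.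
   Context: All varieties are over $\mathbb{C}$. A camera is a full-rank $(h+1)\times(N+1)$ matrix $C$, inducing a rational map $\mathbb{P}^N\dashrightarrow\mathbb{P}^h$, $X\mapsto CX$; its center is the projective subspace $c=\mathbb{P}(\ker C)\subseteq\mathbb{P}^N$. For an arrangement $\mathbf{C}=(C_1,\dots,C_n)$ of cameras of size $(h+1)\times(N+1)$, the point multiview variety $\mathcal{M}_{\mathbf{C}}^{N,h}$ is the Zariski closure of the image of $\mathbb{P}^N\dashrightarrow(\mathbb{P}^h)^n$, $X\mapsto(C_1X,\dots,C_nX)$. $c_i$ denotes the center of $C_i$ and $c_I=\bigcap_{i\in I}c_i$ for nonempty $I\subseteq\{1,\dots,n\}$. For $x=(x_1,\dots,x_n)\in(\mathbb{P}^h)^n$, $$M_{\mathbf{C}}(x)=\begin{bmatrix}C_1&x_1&0&\cdots&0\\C_2&0&x_2&\cdots&0\\\vdots&\vdots&\vdots&\ddots&\vdots\\C_n&0&0&\cdots&x_n\end{bmatrix},$$ an $(h+1)n\times(N+1+n)$ matrix. For $x\in\mathbb{P}^1$, $\widetilde{x}=\begin{bmatrix}0&1\\-1&0\end{bmatrix}x$. Ranks are independent of the choice of homogeneous representatives.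
   Formalization: In (P2) the equivalence with pairwise distinct centers is claimed only for N ≥ 2; for N = 1 the target is the single point (P^0)^n, so the equality always holds, even with coinciding centers (C_1 = C_2 = [1 0]), and the theorem states just that. *)

(* Defs.v *)
From HB Require Import structures.
From mathcomp Require Import all_boot all_order all_algebra.
From mathcomp Require Import mpoly complex.
From mathcomp Require Import boolp classical_sets reals.

Set Implicit Arguments.
Unset Strict Implicit.
Unset Printing Implicit Defensive.

Import Order.TTheory GRing.Theory Num.Theory.
Local Open Scope classical_set_scope.
Local Open Scope ring_scope.

Section Projective.
Variable K : fieldType.

(* P^h is the set of lines through 0 in K^(h+1).                              *)
Definition proj (h : nat) := {L : {vspace 'cV[K]_h.+1} | \dim L == 1%N}.

(* A vector of homogeneous coordinates: vpick is nonzero on nonzero spaces.   *)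
Definition coords h (x : proj h) : 'cV[K]_h.+1 := vpick (val x).

(* The projective subspace P(W) is represented by the linear subspace W, so   *)
(* it is empty when W = 0, and then has dimension -1.                         *)
Definition projdim h (W : {vspace 'cV[K]_h.+1}) : int := (\dim W)%:Z - 1.

(* The j-th coordinate of the i-th factor of (P^h)^n is the variable of index *)
(* mxvec_index i j; multihomogeneous means homogeneous in each of the n       *)
(* groups of variables.                                                       *)
Definition multihomog n h (p : {mpoly K[n * h.+1]}) : Prop :=
  exists d : 'I_n -> nat, forall m, m \in msupp p ->
    forall i : 'I_n, (\sum_(j < h.+1) m (mxvec_index i j))%N = d i.

(* For multihomogeneous p, vanishing does not depend on the choice of coords. *)
Definition vanishes n h (p : {mpoly K[n * h.+1]}) (x : 'I_n -> proj h) : Prop :=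
  p.@[mxvec (\matrix_(i < n, j < h.+1) coords (x i) j 0) 0] = 0.

Definition zariski_closed n h (Z : set ('I_n -> proj h)) : Prop :=
  exists S : set {mpoly K[n * h.+1]}, (forall p, S p -> multihomog p) /\
    Z = [set x | forall p, S p -> vanishes p x].

Definition zariski_closure n h (A : set ('I_n -> proj h)) :
  set ('I_n -> proj h) := smallest (@zariski_closed n h) A.

End Projective.

Section Cameras.
Variable K : fieldType.

(* An arrangement of n matrices of size (h+1) x (N+1).                        *)
Definition arrangement n N h := 'I_n -> 'M[K]_(h.+1, N.+1).

Definition full_rank m p (A : 'M[K]_(m, p)) : bool := \rank A == minn m p.

Definition center h N (C : 'M[K]_(h.+1, N.+1)) : {vspace 'cV[K]_N.+1} :=
  lker (linfun (mulmx C : 'cV[K]_N.+1 -> 'cV[K]_h.+1)).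

Definition centerI n N h (C : arrangement n N h) (I : {set 'I_n}) :
  {vspace 'cV[K]_N.+1} := (\bigcap_(i in I) center (C i))%VS.

(* The image of X |-> (C_1 X, ..., C_n X), defined at the X outside all the   *)
(* centers.                                                                   *)
Definition camera_image n N h (C : arrangement n N h) :
  set ('I_n -> proj K h) :=
  [set x | exists X : proj K N, forall i : 'I_n,
     C i *m coords X != 0 /\ val (x i) = <[C i *m coords X]>%VS].

Definition multiview n N h (C : arrangement n N h) : set ('I_n -> proj K h) :=
  zariski_closure (camera_image C).

Definition cols_mx m n (f : 'I_n -> 'cV[K]_m) : 'M[K]_(m, n) :=
  \matrix_(k < m, i < n) f i k 0.

(* The i-th row block is [C_i | 0 ... x_i ... 0], with x_i in column i.       *)
Definition multiview_mx n N h (C : arrangement n N h) (x : 'I_n -> proj K h) :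
  'M[K]_(\sum_(i < n) h.+1, N.+1 + n) :=
  \mxcol_(i < n)
    row_mx (C i) (cols_mx (fun j : 'I_n => if j == i then coords (x i) else 0)).

(* x |-> [0 1; -1 0] x                                                        *)
Definition tilde (v : 'cV[K]_2) : 'cV[K]_2 :=
  (block_mx 0 1%:M (- 1%:M) 0 : 'M[K]_(1 + 1)) *m v.

End Cameras.

(* Main.v *)
Require Import Defs.
From HB Require Import structures.
From mathcomp Require Import all_boot all_order all_algebra perm.
From mathcomp Require Import mpoly complex.
From mathcomp Require Import boolp classical_sets reals.
Import Order.TTheory GRing.Theory Num.Theory.
Set Implicit Arguments.
Unset Strict Implicit.
Unset Printing Implicit Defensive.
Local Open Scope ring_scope.

(** All three parts follow from one description of the multiview variety
    (multiviewE).  Write c_J for the common center of the cameras indexed by J,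
    as a linear subspace, and say that a vector Y is incident to x on J when
    C_i Y lies on the line x_i for every i in J.  Then x belongs to the variety
    if and only if, for every nonempty J, some Y outside c_J is incident to x
    on J.

    The condition is necessary because, for each J, it is closed and holds on
    the image of the cameras.  It is closed because, once Y is read modulo c_J,
    it asks for a nonzero vector in the kernel of a matrix whose columns are
    constant or linear in a single x_i, so that its maximal minors are
    multihomogeneous equations (zariski_closed_incidence, closed_incident).

    It is sufficient because x is then the limit of a curve of image points:
    take Y_0 for the set of all indices, then Y_1 for the set of those i with
    C_i Y_0 = 0, then Y_2 for the set of those of them with C_i Y_1 = 0, and so
    on.  Along X(t) = Y_0 + t Y_1 + t^2 Y_2 + ... every C_i X(t), divided by a
    power of t, tends to a nonzero vector of x_i (curve_of_incident).  A
    multihomogeneous polynomial vanishing on the image vanishes along the curve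
    for almost all t, hence at the limit (multiview_of_incident).

    Each of the three rank conditions says that some nonzero Y is incident to x
    on all indices (rank_preimagesP, rank_multiview_mxP, rank_tildeP).  Hence
    the claimed equality holds if and only if every such x satisfies the condition
    for every J with c_J nonzero (multiview_eq_incident):
    - for invertible cameras c_J is always zero;
    - if the centers are single points and pairwise distinct, c_J is nonzero
      only for singletons J, where surjectivity of the camera provides Y; when
      two centers agree, the incident vector may be taken there, so that x_i and
      x_j are arbitrary and can violate the condition for the pair {i, j};
    - for cameras to the projective line, incidence on J amounts to #|J| linear
      equations on Y, so Y outside c_J exists when the codimension of c_J
      exceeds #|J|.  Conversely, on a smallest J where this fails, Rado's
      theorem on independent transversals (rado) provides x for which these
      equations cut out exactly c_J. *)

(** * Independent transversals of subspaces *)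

Section Rado.
Variables (K : fieldType) (I : finType) (q : nat) (V : I -> 'M[K]_q).

(** Rado's theorem, relative to a subspace B.  The induction is that of Halmos
    and Vaughan for Hall's theorem: if the rank bound is tight on a nonempty
    proper J, a transversal of J followed by one of the remaining indices modulo
    B + V_J will do; otherwise the slack allows adjoining to B any vector of any
    V_i outside B.  Enlarging B stands for passing to a quotient. *)
Lemma rado (A : {set I}) (B : 'M_q) :
  (forall J : {set I}, J \subset A ->
     #|J| + \rank B <= \rank (B + \sum_(i in J) V i)%MS)%N ->
  exists v : I -> 'rV_q, (forall i, i \in A -> (v i <= V i)%MS) /\
    \rank (B + \sum_(i in A) <<v i>>)%MS = (#|A| + \rank B)%N.
Proof.
have [k] := ubnP #|A|; elim: k A B => // k IHk A B ltAk hall.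
have [->|A0] := eqVneq A finset.set0.
  exists (fun=> 0); split=> [i|]; first by rewrite inE.
  by rewrite big_set0 addsmx0 cards0.
have [/existsP[/= J /and3P[J0 JA tight]]|/existsPn slack] :=
  boolP [exists J : {set I}, [&& J != finset.set0, J \proper A &
    \rank (B + \sum_(i in J) V i)%MS <= #|J| + \rank B]%N].
- have sJA := proper_sub JA.
  have [||v1 [v1V rk1]] := IHk J B.
  + exact: leq_trans (proper_card JA) ltAk.
  + by move=> L LJ; apply: hall; apply: fintype.subset_trans LJ sJA.
  (* Tightness means that the transversal of J spans V_J modulo B. *)
  have BE : (B + \sum_(i in J) <<v1 i>> :=: B + \sum_(i in J) V i)%MS.
    apply/eqmxP; rewrite -mxrank_leqif_eq; last first.
      apply: addsmxS => //; apply: sumsmxS => i iJ.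
      by rewrite genmxE v1V.
    by rewrite rk1 eqn_leq tight andbT hall.
  have sumJ (L : {set I}) (F : I -> 'M[K]_q) : [disjoint J & L] ->
      (B + \sum_(i in J :|: L) F i =
       B + \sum_(i in J) F i + \sum_(i in L) F i)%MS.
    move=> dJL; rewrite -addsmxA; congr (_ + _)%MS; rewrite -bigU //.
    by apply: eq_bigl => i; rewrite !inE.
  have cardJ (L : {set I}) : [disjoint J & L] -> #|J :|: L| = (#|J| + #|L|)%N.
    by move=> dJL; rewrite cardsU disjoint_setI0 // cards0 subn0.
  have [||v2 [v2V rk2]] := IHk (A :\: J) (B + \sum_(i in J) V i)%MS.
  + apply: leq_trans (proper_card _) (ltAk : #|A| <= k)%N.
    apply/properP; split; first exact: subsetDl.
    have /set0Pn[j jJ] := J0; exists j; rewrite ?(fintype.subsetP sJA) //.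
    by rewrite inE jJ.
  + move=> L; rewrite subsetD disjoint_sym => /andP[LA dJL].
    rewrite -sumJ // -BE rk1 addnA [(#|L| + _)%N]addnC -cardJ //.
    by apply: hall; rewrite finset.subUset sJA.
  have dJA : [disjoint J & A :\: J].
    rewrite disjoint_sym finset.disjoints_subset finset.setDE.
    exact: finset.subsetIr.
  have AE : J :|: A :\: J = A.
    apply/setP => i; rewrite !inE; case: (boolP (i \in J)) => //= iJ.
    by rewrite (fintype.subsetP sJA).
  exists (fun i => if i \in J then v1 i else v2 i); split=> [i iA|].
    by case: ifP => iJ; [exact: v1V|apply: v2V; rewrite inE iJ].
  rewrite -[in LHS]AE -[in RHS]AE sumJ // cardJ // addnAC -rk1 BE addnC -rk2.
  have -> : (\sum_(i in J) <<if i \in J then v1 i else v2 i>> =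
             \sum_(i in J) <<v1 i>>)%MS by apply: eq_bigr => i ->.
  have -> : (\sum_(i in (A :\: J)%SET) <<if i \in J then v1 i else v2 i>> =
             \sum_(i in (A :\: J)%SET) <<v2 i>>)%MS.
    by apply: eq_bigr => i; rewrite inE => /andP[/negPf->].
  by rewrite (adds_eqmx BE (eqmx_refl _)).
- have [i iA] := set0Pn _ A0.
  have sub1 : [set i] \subset A by rewrite finset.sub1set.
  have /row_subPn[k' wB] : ~~ (V i <= B)%MS.
    apply: contraTN (hall _ sub1); rewrite big_set1 cards1 => ViB.
    by rewrite -ltnNge ltnS mxrankS // addsmx_sub submx_refl ViB.
  pose w := row k' (V i).
  have rkw : \rank (B + <<w>>)%MS = (\rank B).+1.
    apply/eqP; rewrite eqn_leq; apply/andP; split.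
      apply: leq_trans (mxrank_adds_leqif _ _) _.
      by rewrite -[leqRHS]addn1 leq_add2l mxrank_gen rank_leq_row.
    rewrite ltn_neqAle !(mxrank_leqif_sup (addsmxSl _ _)) andbT.
    by rewrite addsmx_sub submx_refl genmxE.
  have [||v [vV rkv]] := IHk (A :\ i) (B + <<w>>)%MS.
  + by move: ltAk; rewrite (cardsD1 i) iA.
  + move=> J; rewrite subsetD1 => /andP[JA iJ]; rewrite rkw addnS.
    have [->|J0] := eqVneq J finset.set0.
      by rewrite big_set0 addsmx0 cards0 rkw.
    have := slack J; rewrite J0 finset.properEneq JA andbT /=.
    have -> /= : J != A by apply: contraNneq iJ => ->.
    rewrite -ltnNge => /leq_trans; apply; apply: mxrankS.
    by rewrite addsmxS ?addsmxSl.
  exists (fun j => if j == i then w else v j); split=> [j jA|].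
    by case: eqP => [->|/eqP ji]; [exact: row_sub|apply: vV; rewrite !inE ji].
  rewrite (big_setD1 i) //= eqxx addsmxA (eq_bigr (fun j => <<v j>>%MS)).
    by rewrite rkv rkw (cardsD1 i A) iA addnS.
  by move=> j; rewrite !inE => /andP[/negPf->].
Qed.

End Rado.

(** * Multihomogeneous polynomials *)

Local Open Scope classical_set_scope.

Lemma bigDmxvec (T : Type) (idx : T) (op : Monoid.com_law idx) (m n : nat)
    (F : 'I_(m * n) -> T) :
  \big[op/idx]_k F k = \big[op/idx]_i \big[op/idx]_j F (mxvec_index i j).
Proof.
by rewrite pair_bigA (reindex _ (curry_mxvec_bij m n)); apply: eq_bigr; case.
Qed.

Section Multihomogeneous.
Variables (K : fieldType) (n h : nat).
Implicit Types (p q : {mpoly K[n * h.+1]}) (d : 'I_n -> nat).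

(** multihomog with the multidegree exposed, so that it can be computed. *)
Definition of_multidegree d p : Prop :=
  forall m, m \in msupp p ->
    forall i : 'I_n, (\sum_(j < h.+1) m (mxvec_index i j))%N = d i.

Lemma of_multidegreeC (c : K) : of_multidegree (fun=> 0%N) c%:MP.
Proof.
move=> m; rewrite msuppC; case: eqP => // _; rewrite inE => /eqP-> i.
by apply: big1 => j _; rewrite mnm0E.
Qed.

Lemma of_multidegree0 d : of_multidegree d 0.
Proof. by move=> m; rewrite msupp0. Qed.

Lemma of_multidegreeX i a :
  of_multidegree (fun l => (l == i) : nat) 'X_(mxvec_index i a).
Proof.
move=> m; rewrite msuppX inE => /eqP-> l.
under eq_bigr do rewrite mnm1E.
have inj : injective (uncurry (@mxvec_index n h.+1)).
  exact: bij_inj (onT_bij (curry_mxvec_bij n h.+1)).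
have E j : (mxvec_index i a == mxvec_index l j) = (l == i) && (j == a).
  apply/eqP/andP => [e|[/eqP-> /eqP->]//].
  by case: (inj (i, a) (l, j) e) => -> ->.
under eq_bigr do rewrite E.
rewrite (bigD1 a) //= eqxx andbT big1 ?addn0 // => j /negPf->.
by rewrite andbF.
Qed.

Lemma of_multidegreeM d1 d2 p q :
  of_multidegree d1 p -> of_multidegree d2 q ->
  of_multidegree (fun i => d1 i + d2 i)%N (p * q).
Proof.
move=> hp hq m /msuppM_le/allpairsP[[m1 m2] /= [m1p m2q ->]] i.
under eq_bigr do rewrite mnmDE.
by rewrite big_split /= hp // hq.
Qed.

Lemma of_multidegree_sum (I : finType) d (F : I -> {mpoly K[n * h.+1]}) :
  (forall s, of_multidegree d (F s)) -> of_multidegree d (\sum_s F s).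
Proof.
move=> hF; apply: (big_ind (of_multidegree d)) => //.
  exact: of_multidegree0.
move=> p q hp hq m /msuppD_le; rewrite mem_cat => /orP[]; first exact: hp.
exact: hq.
Qed.

Lemma of_multidegree_prod (I : finType) (d : I -> 'I_n -> nat)
    (F : I -> {mpoly K[n * h.+1]}) :
  (forall k, of_multidegree (d k) (F k)) ->
  of_multidegree (fun i => \sum_k d k i)%N (\prod_k F k).
Proof.
move=> hF; elim: (index_enum I) => [|k s IHs].
  by rewrite big_nil => m /of_multidegreeC hm i; rewrite hm big_nil.
rewrite big_cons => m /(of_multidegreeM (hF k) IHs) hm i.
by rewrite hm big_cons.
Qed.

(** The degree is attached to columns, since every term of the Leibniz formula
    takes exactly one entry from each column. *)
Lemma of_multidegree_det (r : nat) (A : 'M[{mpoly K[n * h.+1]}]_r)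
    (d : 'I_r -> 'I_n -> nat) :
  (forall k l, of_multidegree (d l) (A k l)) ->
  of_multidegree (fun i => \sum_l d l i)%N (\det A).
Proof.
move=> hA; apply: of_multidegree_sum => s m.
rewrite -signr_odd mulr_sign => hm i.
have {}hm : m \in msupp (\prod_k A k (s k)).
  by move: hm; case: ifP => // _; rewrite (perm_mem (msuppN _)).
rewrite (of_multidegree_prod (fun k => hA k (s k)) hm).
by rewrite [RHS](reindex_inj (@perm_inj _ s)).
Qed.

Lemma of_multidegree_scale d p (a : 'I_n -> K) (v : 'M[K]_(n, h.+1)) :
  of_multidegree d p ->
  p.@[mxvec (\matrix_(i, j) (a i * v i j)) 0] =
    (\prod_i a i ^+ d i) * p.@[mxvec v 0].
Proof.
move=> hp; rewrite !mevalE big_distrr /=; apply: eq_big_seq => m mp.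
rewrite mulrCA; congr (_ * _); rewrite !bigDmxvec -big_split /=.
apply: eq_bigr => i _; rewrite -(hp m mp i) expr_sum -big_split /=.
by apply: eq_bigr => j _; rewrite !mxvecE mxE exprMn.
Qed.

End Multihomogeneous.

(** * Incidence is closed *)

Section Incidence.
Variables (K : fieldType) (n h : nat).

Lemma coords_neq0 (x : proj K h) : coords x != 0.
Proof.
rewrite /coords vpick0; apply: contraTneq (valP x) => ->.
by rewrite dimv0.
Qed.

Lemma coords_mem (x : proj K h) : coords x \in val x.
Proof. exact: memv_pick. Qed.

Lemma val_projE (x : proj K h) (v : 'cV_h.+1) :
  v != 0 -> v \in val x -> val x = <[v]>%VS.
Proof.
move=> v0 vx; apply/eqP; rewrite eq_sym eqEdim -memvE vx.
by rewrite (eqP (valP x)) dim_vline v0.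
Qed.

Lemma mem_projP (x : proj K h) (v : 'cV_h.+1) :
  reflect (exists a, v = a *: coords x) (v \in val x).
Proof.
by rewrite (val_projE (coords_neq0 x) (coords_mem x)); exact: vlineP.
Qed.

Lemma proj_line (v : 'cV[K]_h.+1) : v != 0 ->
  exists x : proj K h, val x = <[v]>%VS.
Proof.
move=> v0; have dv : \dim <[v]> == 1%N by rewrite dim_vline v0.
by exists (exist (fun L : {vspace 'cV[K]_h.+1} => \dim L == 1%N) _ dv).
Qed.

Lemma proj_through (v : 'cV[K]_h.+1) : exists x : proj K h, v \in val x.
Proof.
have [->|v0] := eqVneq v 0; last first.
  by have [x xE] := proj_line v0; exists x; rewrite xE memv_line.
have [|x _] := @proj_line (const_mx 1); last by exists x; exact: mem0v.
by apply: contra_neq (oner_neq0 K) => /matrixP/(_ 0 0); rewrite !mxE.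
Qed.

Lemma row_fullPn (q m : nat) (A : 'M[K]_(q, m)) :
  reflect (exists2 v : 'cV_m, v != 0 & A *m v = 0) (~~ row_full A).
Proof.
apply: (iffP idP) => [|[v v0 Av]]; last first.
  apply: contra_neqN v0 => fA.
  by rewrite -[v]mul1mx -(mulVpmx fA) -mulmxA Av mulmx0.
rewrite -cokermx_eq0 => nz.
have [j nzj] : exists j, col j (cokermx A) != 0.
  apply/existsP; apply: contraNT nz => /existsPn z; apply/eqP/matrixP => i j.
  by have /negPn/eqP/matrixP/(_ i 0) := z j; rewrite !mxE.
by exists (col j (cokermx A)) => //; rewrite colE mulmxA mulmx_coker mul0mx.
Qed.

Lemma det_rowsub_eq0P (q m : nat) (A : 'M[K]_(q, m)) :
  ~~ row_full A <-> (forall f : 'I_m -> 'I_q, \det (rowsub f A) = 0).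
Proof.
split=> [/row_fullPn[v v0 Av] f|dA].
  apply: contra_neq_eq v0; rewrite -unitfE -unitmxE => uA.
  apply: (can_inj (mulKmx uA)); rewrite mulmx0.
  have -> : rowsub f A *m v = rowsub f (A *m v) by rewrite mul_rowsub_mx.
  by rewrite Av; apply/matrixP => i j; rewrite !mxE.
by apply/negP => fA; have := fullrowsub_unit fA; rewrite unitmxE dA unitr0.
Qed.

(** As the lines x_i are spanned by nonzero vectors, the coefficients of the
    B_i Z on them can be adjoined to the unknowns; this turns incidence into a
    linear system whose entries are linear in the coordinates of x. *)
Lemma incidence_lift (p : nat) (B : 'I_n -> 'M[K]_(h.+1, p))
    (x : 'I_n -> proj K h) :
  (exists2 Z : 'cV_p, Z != 0 & forall i, B i *m Z \in val (x i)) <->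
  (exists2 v : 'cV_(p + n), v != 0 &
    forall i, B i *m usubmx v + dsubmx v i 0 *: coords (x i) = 0).
Proof.
split=> [[Z Z0 BZ]|[v v0 Bv]].
  have {BZ} /choice[a BZ] i : exists a, B i *m Z = a *: coords (x i).
    exact/mem_projP.
  exists (col_mx Z (- \col_i a i)).
    by apply: contra_neq Z0 => /eqP; rewrite col_mx_eq0 => /andP[/eqP].
  by move=> i; rewrite col_mxKu col_mxKd BZ !mxE scaleNr subrr.
have BZ i : B i *m usubmx v = - dsubmx v i 0 *: coords (x i).
  by apply/eqP; rewrite scaleNr -addr_eq0 Bv.
exists (usubmx v); last by move=> i; apply/mem_projP; exists (- dsubmx v i 0).
apply: contra_neq v0 => u0; rewrite -(vsubmxK v) u0.
have -> : dsubmx v = 0; last by rewrite col_mx0.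
apply/matrixP => i l; rewrite ord1 [RHS]mxE; apply/eqP.
move/eqP: (BZ i); rewrite u0 mulmx0 eq_sym scaler_eq0 oppr_eq0.
by rewrite (negPf (coords_neq0 _)) orbF.
Qed.

(** The equations are the maximal minors of the system of incidence_lift: its
    first p columns are constant and the column p + i is linear in x_i. *)
Lemma zariski_closed_incidence (p : nat) (B : 'I_n -> 'M[K]_(h.+1, p)) :
  zariski_closed [set x : 'I_n -> proj K h |
    exists2 Z : 'cV_p, Z != 0 & forall i, B i *m Z \in val (x i)].
Proof.
(* Rows are indexed by pairs (i, a), the a-th equation of the i-th camera. *)
pose entry (i : 'I_n) (a : 'I_h.+1) (l : 'I_(p + n)) : {mpoly K[n * h.+1]} :=
  match split l with
  | inl b => (B i a b)%:MP
  | inr j => if j == i then 'X_(mxvec_index i a) else 0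
  end.
pose P := \matrix_(k, l) mxvec (\matrix_(i, a) entry i a l) 0 k.
exists [set \det (rowsub f P) | f in [set: 'I_(p + n) -> 'I_(n * h.+1)]].
split=> [_ [f _ <-]|].
  pose d (l : 'I_(p + n)) (i : 'I_n) : nat :=
    if split l is inr j then i == j else 0%N.
  exists (fun i => \sum_l d l i)%N; apply: of_multidegree_det => k l.
  rewrite !mxE; case/mxvec_indexP: (f k) => i a; rewrite mxvecE mxE /entry /d.
  case: (split l) => [b|j]; first exact: of_multidegreeC.
  case: eqP => [->|_]; last exact: of_multidegree0.
  exact: of_multidegreeX.
have zeroP (x : 'I_n -> proj K h) :
    (exists2 Z : 'cV_p, Z != 0 & forall i, B i *m Z \in val (x i)) <->
    ~~ row_full (map_mx (meval (mxvec (\matrix_(i, j) coords (x i) j 0) 0)) P).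
  pose Px := map_mx (meval (mxvec (\matrix_(i, j) coords (x i) j 0) 0)) P.
  have PxE (v : 'cV_(p + n)) i a : (Px *m v) (mxvec_index i a) 0 =
      (B i *m usubmx v + dsubmx v i 0 *: coords (x i)) a 0.
    rewrite !mxE big_split_ord /=; congr (_ + _).
      apply: eq_bigr => b _; rewrite !mxE mxvecE mxE /entry.
      by rewrite (unsplitK (inl b)) mevalC.
    rewrite (bigD1 i) //= big1 => [|j ji].
      rewrite !mxE mxvecE mxE /entry (unsplitK (inr i)) eqxx mevalXU.
      by rewrite mxvecE mxE addr0 mulrC.
    rewrite !mxE mxvecE mxE /entry (unsplitK (inr j)) (negPf ji).
    by rewrite meval0 mul0r.
  split=> [/incidence_lift[v v0 Bv]|/row_fullPn[v v0 Pv]].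
    apply/row_fullPn; exists v => //; apply/matrixP => k l; rewrite ord1.
    by case/mxvec_indexP: k => i b; rewrite PxE Bv !mxE.
  apply/incidence_lift; exists v => // i; apply/matrixP => b l.
  by rewrite ord1 -PxE Pv !mxE.
apply/seteqP; split=> x /=.
  move=> /zeroP/det_rowsub_eq0P dP _ [f _ <-]; rewrite /vanishes.
  by rewrite -det_map_mx map_mxsub.
move=> van; apply/zeroP/det_rowsub_eq0P => f.
by rewrite -map_mxsub det_map_mx; apply: van; exists f.
Qed.

End Incidence.

(** * The multiview variety in terms of incidence *)

Lemma exists_nonroot (K : numFieldType) (p : {poly K}) :
  p != 0 -> exists t, p.[t] != 0.
Proof.
move=> p0; apply/not_existsP => pr.
have /(max_poly_roots p0) : all (root p) [seq k%:R | k <- iota 0 (size p)].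
  by apply/allP => _ /mapP[k _ ->]; apply/rootP/eqP/negPn/negP/pr.
rewrite size_map size_iota ltnn => /(_ _)/negP[] //.
by rewrite map_inj_uniq ?iota_uniq // => k l /eqP; rewrite eqr_nat => /eqP.
Qed.

Lemma horner_map_polyC (K : comNzRingType) (m1 m2 : nat) (A : 'M[K]_(m1, m2))
    t :
  map_mx (horner_eval t) (map_mx polyC A) = A.
Proof. by apply/matrixP => b c; rewrite !mxE /horner_eval hornerC. Qed.

Lemma horner_mmap (K : comNzRingType) (r : nat) (p : {mpoly K[r]})
    (q : 'I_r -> {poly K}) t :
  (mmap polyC q p).[t] = p.@[fun k => (q k).[t]].
Proof.
rewrite /mmap mevalE horner_sum; apply: eq_bigr => m _.
rewrite hornerM hornerC /mmap1 horner_prod; congr (_ * _).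
by apply: eq_bigr => k _; rewrite horner_exp.
Qed.

Section MultiviewVariety.
Variables (K : numFieldType) (n N h : nat) (C : arrangement K n N h).

Lemma mem_center (D : 'M[K]_(h.+1, N.+1)) Y : (Y \in center D) = (D *m Y == 0).
Proof. by rewrite memv_ker lfunE. Qed.

Lemma mem_centerI (J : {set 'I_n}) Y :
  reflect (forall i, i \in J -> C i *m Y = 0) (Y \in centerI C J).
Proof.
rewrite memvE; apply: (iffP subv_bigcapP) => CY i iJ.
  by apply/eqP; rewrite -mem_center memvE CY.
by rewrite -memvE mem_center CY.
Qed.

Lemma notin_centerI (J : {set 'I_n}) Y :
  reflect (exists2 i, i \in J & C i *m Y != 0) (Y \notin centerI C J).
Proof.
apply: (iffP idP) => [|[i iJ]]; last by apply: contraNN => /mem_centerI->.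
move=> YJ; apply/exists_inP; apply: contraNT YJ => /exists_inPn CY.
by apply/mem_centerI => i /CY/negPn/eqP.
Qed.

Definition incident (x : 'I_n -> proj K h) (J : {set 'I_n}) (Y : 'cV_N.+1) :=
  forall i, i \in J -> C i *m Y \in val (x i).

(** The curve is built by induction on J: a vector outside c_J incident to x on
    J takes care of the cameras that do not kill it, and t times the curve of
    the remaining cameras is added to it without changing the limits already
    obtained.  The factor u is a power of t, of which only u != 0 matters. *)
Lemma curve_of_incident x :
  (forall J : {set 'I_n}, J != finset.set0 ->
     exists2 Y, Y \notin centerI C J & incident x J Y) ->
  forall J : {set 'I_n}, exists Y : 'cV[{poly K}]_N.+1, forall i, i \in J ->
    exists (u : {poly K}) (Q : 'cV[{poly K}]_h.+1) (a : K),
    [/\ u != 0, map_mx polyC (C i) *m Y = u *: Q, a != 0 &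
        map_mx (horner_eval 0) Q = a *: coords (x i)].
Proof.
move=> incx J; have [k] := ubnP #|J|; elim: k J => // k IHk J ltJk.
have [->|/incx[Y0 Y0J Y0x]] := eqVneq J finset.set0.
  by exists 0 => i; rewrite inE.
have [|Y1 Y1E] := IHk [set i in J | C i *m Y0 == 0]%SET.
  apply: leq_trans (_ : _ < #|J|)%N ltJk; apply: proper_card.
  apply/properP; split.
    by apply/fintype.subsetP => i; rewrite inE => /andP[].
  have [i iJ CY0] := notin_centerI _ _ Y0J.
  by exists i; rewrite // inE iJ.
exists (map_mx polyC Y0 + 'X *: Y1) => i iJ.
have [CY0|CY0] := eqVneq (C i *m Y0) 0.
  have [|u [Q [a [u0 CY1 a0 Q0]]]] := Y1E i; first by rewrite inE iJ CY0 eqxx.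
  exists ('X * u), Q, a; split=> //; first by rewrite mulf_neq0 ?polyX_eq0.
  by rewrite mulmxDr -map_mxM CY0 map_mx0 add0r -scalemxAr CY1 scalerA.
have /mem_projP[a aE] := Y0x i iJ.
exists 1, (map_mx polyC (C i) *m (map_mx polyC Y0 + 'X *: Y1)), a.
split; rewrite ?oner_eq0 ?scale1r //.
  by apply: contra_neq CY0 => a0; rewrite aE a0 scale0r.
rewrite -aE map_mxM map_mxD map_mxZ /=.
by rewrite !horner_map_polyC /horner_eval hornerX scale0r addr0.
Qed.

Lemma camera_image_at (X : 'cV[K]_N.+1) : (0 < n)%N ->
  (forall i, C i *m X != 0) ->
  exists2 y, camera_image C y & forall i, val (y i) = <[C i *m X]>%VS.
Proof.
move=> n0 CX; have X0 : X != 0.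
  by apply: contraNneq (CX (Ordinal n0)) => ->; rewrite mulmx0.
have [P PX] := proj_line X0.
have [y yE] := choice (fun i => proj_line (CX i)).
exists y => //; exists P => i.
have := coords_neq0 P.
have : coords P \in val P by exact: coords_mem.
rewrite PX => /vlineP[a ->]; rewrite scaler_eq0 negb_or => /andP[a0 _].
rewrite -scalemxAr scaler_eq0 negb_or a0 CX; split=> //.
rewrite yE; apply/eqP; rewrite eqEsubv -!memvE.
apply/andP; split; apply/vlineP; last by exists a.
by exists a^-1; rewrite scalerA mulVf ?scale1r.
Qed.

(** Rescaling the vector that represents x_i multiplies the value of p by a
    power of the scaling factor. *)
Lemma vanishes_of_lines d (p : {mpoly K[n * h.+1]}) (y : 'I_n -> proj K h)
    (v : 'I_n -> 'cV_h.+1) :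
  of_multidegree d p -> (forall i, v i != 0) -> (forall i, v i \in val (y i)) ->
  vanishes p y <-> p.@[mxvec (\matrix_(i, j) v i j 0) 0] = 0.
Proof.
move=> dp v0 vy.
have {vy}/choice[a aE] i : exists a, v i = a *: coords (y i) by exact/mem_projP.
have a0 : \prod_i a i ^+ d i != 0.
  apply/prodf_neq0 => i _; rewrite expf_neq0 //.
  by apply: contra_neq (v0 i); rewrite aE => ->; rewrite scale0r.
have -> : \matrix_(i, j) v i j 0 =
    \matrix_(i, j) (a i * (\matrix_(i, j) coords (y i) j 0) i j).
  by apply/matrixP => i j; rewrite !mxE aE mxE.
rewrite (of_multidegree_scale _ _ dp).
split=> [->|/eqP]; first by rewrite mulr0.
by rewrite mulf_eq0 (negPf a0) => /eqP.
Qed.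

(** A polynomial p that vanishes on the image is evaluated along the curve; the
    resulting polynomial g in t is zero, as it vanishes whenever the curve gives
    an actual image point, that is outside finitely many t.  Hence g(0) = 0. *)
Lemma multiview_of_incident x : (0 < n)%N ->
  (forall J : {set 'I_n}, J != finset.set0 ->
     exists2 Y, Y \notin centerI C J & incident x J Y) ->
  multiview C x.
Proof.
move=> n0 incx Z [[S [hS ->]] imS] p Sp /=.
have [d dp] := hS p Sp.
have [Y YE] := curve_of_incident incx [set: 'I_n]%SET.
have /choice[u /choice[Q /choice[a uQa]]] := fun i => YE i (finset.in_setT i).
have van t :
    (forall i, map_mx (horner_eval t) (map_mx polyC (C i) *m Y) != 0) ->
    p.@[mxvec (\matrix_(i, j) (Q i j 0).[t]) 0] = 0.
  move=> CYt; pose Qt i := map_mx (horner_eval t) (Q i).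
  have CK i := horner_map_polyC (C i) t.
  have CYtE i : C i *m map_mx (horner_eval t) Y = (u i).[t] *: Qt i.
    have [_ CY _ _] := uQa i.
    by rewrite -[C i](CK i) -map_mxM CY map_mxZ.
  have CYt' i : C i *m map_mx (horner_eval t) Y != 0.
    by rewrite -[C i]CK -map_mxM.
  have [y /imS/(_ p Sp) pan yE] := camera_image_at n0 CYt'.
  have -> : \matrix_(i, j) (Q i j 0).[t] = \matrix_(i, j) Qt i j 0.
    by apply/matrixP => i j; rewrite !mxE.
  apply: (proj1 (vanishes_of_lines (y := y) dp _ _)) pan => i.
    by apply: contraNneq (CYt' i); rewrite CYtE => ->; rewrite scaler0.
  have := CYt' i; rewrite yE CYtE scaler_eq0 negb_or => /andP[ut0 _].
  by apply/vlineP; exists (u i).[t]^-1; rewrite scalerA mulVf ?scale1r.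
pose g := mmap polyC (mxvec (\matrix_(i, j) Q i j 0) 0) p.
have gE t : g.[t] = p.@[mxvec (\matrix_(i, j) (Q i j 0).[t]) 0].
  rewrite horner_mmap; apply: meval_eq => k; case/mxvec_indexP: k => i j.
  by rewrite !mxvecE !mxE.
have g0 : g = 0.
  apply/eqP/negP => /negP gn0.
  have /choice[b bE] i : exists b, Q i b 0 != 0.
    apply/existsP; have [_ _ a0 Q0] := uQa i.
    apply: contraNT (coords_neq0 (x i)) => /existsPn Qi0.
    have /eqP : a i *: coords (x i) = 0.
      rewrite -Q0; apply/matrixP => k l; rewrite ord1 !mxE.
      by have /negPn/eqP-> := Qi0 k; rewrite /horner_eval horner0.
    by rewrite scaler_eq0 (negPf a0).
  (* C_i Y is nonzero at t when u_i and one coordinate of Q_i are. *)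
  have [] := exists_nonroot (p := g * \prod_i (u i * Q i (b i) 0)).
    rewrite mulf_neq0 //; apply/prodf_neq0 => i _.
    by have [u0 _ _ _] := uQa i; rewrite mulf_neq0.
  move=> t; rewrite hornerM horner_prod mulf_eq0 negb_or => /andP[].
  rewrite gE => /eqP + /prodf_neq0 uQt; apply; apply: van => i.
  have := uQt i isT; rewrite hornerM mulf_eq0 negb_or => /andP[ut0 Qt0].
  have [_ -> _ _] := uQa i; rewrite map_mxZ scaler_eq0 negb_or ut0.
  by apply: contra_neq Qt0 => /matrixP/(_ (b i) 0); rewrite !mxE.
apply: (proj2 (vanishes_of_lines (v := fun i => a i *: coords (x i)) dp _ _)).
- move=> i; have [_ _ a0 _] := uQa i.
  by rewrite scaler_eq0 negb_or a0 coords_neq0.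
- by move=> i; apply/mem_projP; exists (a i).
have <- : \matrix_(i, j) (Q i j 0).[0] =
    \matrix_(i, j) (a i *: coords (x i)) j 0.
  apply/matrixP => i j; have [_ _ _ /matrixP/(_ j 0) Q0] := uQa i.
  by move: Q0; rewrite !mxE.
by rewrite -gE g0 horner0.
Qed.

(** The space of linear forms vanishing on c_J. *)
Definition row_sum (J : {set 'I_n}) : 'M[K]_N.+1 := (\sum_(i in J) <<C i>>)%MS.

Lemma mem_centerI_row_sum (J : {set 'I_n}) (m : nat) (T : 'M_(m, N.+1)) Y :
  (T :=: row_sum J)%MS -> (Y \in centerI C J) = (T *m Y == 0).
Proof.
move=> TS; apply/mem_centerI/eqP => [CY|TY i iJ].
  have /sub_sumsmxP[v ->] : (T <= row_sum J)%MS by rewrite TS.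
  rewrite mulmx_suml big1 // => i iJ.
  have /submxP[w ->] : (<<C i>> <= C i)%MS by rewrite genmxE.
  by rewrite -!mulmxA CY // !mulmx0.
have /submxP[w ->] : (C i <= T)%MS by rewrite TS (sumsmx_sup i) ?genmxE.
by rewrite -mulmxA TY mulmx0.
Qed.

Lemma dim_centerI (J : {set 'I_n}) :
  (\dim (centerI C J) + \rank (row_sum J))%N = N.+1.
Proof.
pose T := row_base (row_sum J).
pose f := linfun (mulmx T : 'cV_N.+1 -> 'cV_(\rank (row_sum J))).
have -> : centerI C J = lker f.
  apply/vspaceP => Y; rewrite memv_ker lfunE /=.
  exact: mem_centerI_row_sum (eq_row_base _).
have fT : limg f = fullv.
  apply/eqP; rewrite eqEsubv subvf /=.
  apply/subvP => Z _; apply/memv_imgP; exists (pinvmx T *m Z).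
    exact: memvf.
  by rewrite lfunE /= mulmxA mulmxVp ?mul1mx ?row_base_free.
by have := limg_ker_dim f fullv; rewrite capfv fT !dimvf !dim_matrix !mulr1.
Qed.

(** Independent forms T spanning those that vanish on c_J give coordinates
    Z = T Y modulo c_J, through which the cameras of J factor; the condition
    that Y avoids c_J becomes Z != 0, to which zariski_closed_incidence applies.
    The other cameras are replaced by 0, which is incident to every point. *)
Lemma closed_incident (J : {set 'I_n}) :
  zariski_closed [set x : 'I_n -> proj K h |
    exists2 Y, Y \notin centerI C J & incident x J Y].
Proof.
pose S := row_sum J; pose T := row_base S.
have CT i : i \in J -> C i = C i *m pinvmx T *m T.
  by move=> iJ; rewrite mulmxKpV // eq_row_base (sumsmx_sup i) ?genmxE.
have ker_T Y : (Y \in centerI C J) = (T *m Y == 0).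
  exact: mem_centerI_row_sum (eq_row_base _).
pose B i := if i \in J then C i *m pinvmx T else 0.
suff -> : [set x : 'I_n -> proj K h |
    exists2 Y, Y \notin centerI C J & incident x J Y] =
  [set x : 'I_n -> proj K h |
    exists2 Z : 'cV_(\rank S), Z != 0 & forall i, B i *m Z \in val (x i)].
  exact: zariski_closed_incidence.
apply/seteqP; split=> x /= [].
  move=> Y; rewrite ker_T => TY0 Yx; exists (T *m Y) => // i.
  rewrite /B; case: ifP => [iJ|_]; last by rewrite mul0mx mem0v.
  by rewrite mulmxA -CT // Yx.
move=> Z Z0 BZ; have TZ : T *m (pinvmx T *m Z) = Z.
  by rewrite mulmxA mulmxVp ?mul1mx ?row_base_free.
exists (pinvmx T *m Z); first by rewrite ker_T TZ.
by move=> i iJ; have := BZ i; rewrite /B iJ -mulmxA.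
Qed.

(** The inclusion of the variety holds because the right-hand side is closed and
    an image point C X satisfies every condition with Y = X. *)
Theorem multiviewE : (0 < n)%N ->
  multiview C = [set x | forall J : {set 'I_n}, J != finset.set0 ->
    exists2 Y, Y \notin centerI C J & incident x J Y].
Proof.
move=> n0; apply/seteqP; split=> x; last exact: multiview_of_incident.
move=> + J /set0Pn[j jJ]; move: x.
apply: (smallest_sub (closed_incident J)) => x [X CX]; exists (coords X).
  by apply/notin_centerI; exists j => //; have [] := CX j.
by move=> i _; have [_ ->] := CX i; rewrite memv_line.
Qed.

(** The set on the right is the one described by the rank conditions.  The
    condition of multiviewE for all indices gives a nonzero incident vector, and
    conversely such a vector serves for every J with c_J = 0. *)
Lemma multiview_eq_incident : (0 < n)%N ->
  multiview C = [set x | exists2 Y, Y != 0 & incident x [set: 'I_n]%SET Y] <->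
  (forall x, (exists2 Y, Y != 0 & incident x [set: 'I_n]%SET Y) ->
    forall J : {set 'I_n}, J != finset.set0 -> centerI C J != 0%VS ->
    exists2 Y, Y \notin centerI C J & incident x J Y).
Proof.
move=> n0; split=> [MD x Dx J J0 _|inc].
  have : multiview C x by rewrite MD.
  by rewrite multiviewE //; apply.
rewrite multiviewE //; apply/seteqP; split=> x /=.
  move=> incx; have [|Y YC Yx] := incx [set: 'I_n]%SET.
    by apply/set0Pn; exists (Ordinal n0).
  by exists Y => //; apply: contraNneq YC => ->; rewrite mem0v.
move=> [Y Y0 Yx] J J0; have [cJ|cJ] := eqVneq (centerI C J) 0%VS.
  exists Y; first by rewrite cJ memv0.
  by move=> i _; apply: Yx; rewrite finset.in_setT.
by apply: inc => //; exists Y.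
Qed.

End MultiviewVariety.

(** * Invertible cameras *)

Section Homography.
Variables (K : numFieldType) (n N : nat) (C : arrangement K n N N).
Hypotheses (n_gt0 : (0 < n)%N) (fC : forall i, full_rank (C i)).

Lemma invertible_camera i : C i \in unitmx.
Proof.
by rewrite -row_free_unit /row_free; have := fC i; rewrite /full_rank minnn.
Qed.

(** Rank at most one means that the nonzero columns are all proportional to one
    of them, which is then the incident vector. *)
Lemma rank_preimagesP (x : 'I_n -> proj K N) :
  (\rank (cols_mx (fun i => invmx (C i) *m coords (x i))) <= 1)%N <->
  (exists2 Y, Y != 0 & incident C x [set: 'I_n]%SET Y).
Proof.
have uC := invertible_camera.
set A := cols_mx _; have rowA i : row i A^T = (invmx (C i) *m coords (x i))^T.
  by apply/matrixP => a k; rewrite !mxE ord1.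
have rowA0 i : row i A^T != 0.
  rewrite rowA; apply: contra_neq (coords_neq0 (x i)) => /eqP.
  rewrite trmx_eq0 => /eqP e.
  by rewrite -(mulKVmx (uC i) (coords (x i))) e mulmx0.
split=> [rkA|[Y Y0 Yx]].
  pose i0 := Ordinal n_gt0; exists (row i0 A^T)^T.
    by rewrite trmx_eq0.
  have sA : (A^T <= row i0 A^T)%MS.
    rewrite -(mxrank_leqif_sup (row_sub i0 A^T)) eqn_leq.
    rewrite mxrankS ?row_sub //= mxrank_tr (leq_trans rkA) // lt0n.
    by rewrite mxrank_eq0.
  move=> i _; apply/mem_projP.
  have /sub_rVP[a aE] := submx_trans (row_sub i A^T) sA.
  have a0 : a != 0 by apply: contra_neq (rowA0 i) => a0; rewrite aE a0 scale0r.
  exists a^-1; apply: (canLR (mulKVmx (uC i))).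
  rewrite -scalemxAr -[invmx _ *m _]trmxK -rowA aE linearZ /= scalerA.
  by rewrite mulVf ?scale1r.
have /choice[c cE] i : exists a, invmx (C i) *m coords (x i) = a *: Y.
  have /mem_projP[a aE] := Yx i (finset.in_setT i).
  have a0 : a != 0.
    apply: contra_neq Y0 => a0; rewrite -(mulKmx (uC i) Y) aE a0.
    by rewrite scale0r mulmx0.
  exists a^-1; apply: (canLR (mulKmx (uC i))).
  by rewrite -scalemxAr aE scalerA mulVf ?scale1r.
have -> : A = Y *m \row_i c i.
  by apply/matrixP => k i; rewrite mxE cE !mxE big_ord1 !mxE mulrC.
by apply: leq_trans (mxrankM_maxl _ _) (rank_leq_col _).
Qed.

Lemma multiview_homographies :
  multiview C = [set x |
    (\rank (cols_mx (fun i => invmx (C i) *m coords (x i))) <= 1)%N].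
Proof.
have [_ ->] := multiview_eq_incident C n_gt0.
  by apply/seteqP; split=> x /rank_preimagesP.
move=> x _ J /set0Pn[j jJ] /eqP[]; apply/eqP; rewrite -subv0.
apply/subvP => Y /mem_centerI/(_ j jJ) CY.
by rewrite memv0 -(mulKmx (invertible_camera j) Y) CY mulmx0.
Qed.

End Homography.

(** * Cameras whose centers are points *)

(** The right kernel of the matrix is the linear system of incidence_lift. *)
Lemma rank_multiview_mxP (K : numFieldType) (n N h : nat)
    (C : arrangement K n N h) (x : 'I_n -> proj K h) :
  (\rank (multiview_mx C x) <= N + n)%N <->
  (exists2 Y, Y != 0 & incident C x [set: 'I_n]%SET Y).
Proof.
have -> : (\rank (multiview_mx C x) <= N + n)%N =
    ~~ row_full (multiview_mx C x).
  by rewrite /row_full eqn_leq rank_leq_col -ltnNge ltnS.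
have MxE (v : 'cV_(N.+1 + n)) : multiview_mx C x *m v =
    \mxcol_i (C i *m usubmx v + dsubmx v i 0 *: coords (x i)).
  rewrite mxcol_mul; apply: eq_mxcol => i.
  rewrite -[in LHS](vsubmxK v) mul_row_col; congr (_ + _).
  apply/matrixP => k l; rewrite !mxE (bigD1 i) //= big1 => [|j ji].
    by rewrite !mxE eqxx addr0 mulrC !ord1.
  by rewrite !mxE (negPf ji) mxE mul0r.
split=> [/row_fullPn[v v0]|[Y Y0 Yx]].
  rewrite MxE -(@mxcol0 _ n (fun=> h.+1) 1) => /eq_mxcolP Mv.
  have [|Y Y0 Yx] := (incidence_lift C x).2; first by exists v.
  by exists Y.
have [|v v0 Mv] := (incidence_lift C x).1.
  by exists Y => // i; apply: Yx; rewrite finset.in_setT.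
apply/row_fullPn; exists v => //.
by rewrite MxE -(@mxcol0 _ n (fun=> h.+1) 1); apply: eq_mxcol.
Qed.

Section Conical.
Variables (K : numFieldType) (n N : nat) (C : arrangement K n N.+1 N).
Hypotheses (n_gt0 : (0 < n)%N) (fC : forall i, full_rank (C i)).

Lemma rank_camera i : \rank (C i) = N.+1.
Proof. by apply/eqP; have := fC i; rewrite /full_rank (minn_idPl _). Qed.

Lemma dim_center i : \dim (center (C i)) = 1%N.
Proof.
have := dim_centerI C [set i]%SET.
rewrite /centerI /row_sum !big_set1 mxrank_gen rank_camera.
exact: (@addIn N.+1 _ 1%N).
Qed.

Lemma camera_surj i (v : 'cV_N.+1) : exists Y, C i *m Y = v.
Proof.
exists (pinvmx (C i) *m v); rewrite mulmxA mulmxVp ?mul1mx //.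
by rewrite /row_free rank_camera.
Qed.

(** If C_i and C_j have the same center, the images x_i and x_j of two vectors
    Y1 and Y2 that are independent modulo it violate the condition for the pair
    {i, j}; there is room for this as soon as N > 0.  For N = 0 the lines x_i are
    the whole target and incidence holds trivially. *)
Lemma multiview_conical :
  multiview C = [set x | (\rank (multiview_mx C x) <= N.+1 + n)%N] <->
  ((1 < N.+1)%N -> forall i j : 'I_n, i != j -> center (C i) != center (C j)).
Proof.
have -> : [set x | (\rank (multiview_mx C x) <= N.+1 + n)%N] =
    [set x | exists2 Y, Y != 0 & incident C x [set: 'I_n]%SET Y].
  by apply/seteqP; split=> x /rank_multiview_mxP.
split=> [/(multiview_eq_incident C n_gt0) inc N1 i j ij|dist].
  apply/eqP => cij; pose W := center (C i).
  have W0 : W != 0%VS by rewrite -dimv_eq0 dim_center.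
  have outside (U : {vspace 'cV[K]_N.+2}) : (\dim U <= 2)%N ->
      exists Y, Y \notin U.
    move=> dU; have : ~~ (fullv <= U)%VS.
      apply: contraTN dU => /dimvS; rewrite dimvf dim_matrix mulr1 -ltnNge.
      exact: leq_trans.
    by case/subvPn => Y _ YU; exists Y.
  have [|Y1 Y1W] := outside W; first by rewrite dim_center.
  have [|Y2 Y2W] := outside (W + <[Y1]>)%VS.
    apply: leq_trans (dimv_add_leqif _ _) _.
    by rewrite dim_center dim_vline addnC; case: (Y1 != 0).
  (* The common center X0 is incident to x whatever x_i and x_j are. *)
  pose X0 := vpick W.
  have X0W : X0 \in W by exact: memv_pick.
  pose u k := if k == i then C i *m Y1 else if k == j then C j *m Y2
              else C k *m X0.
  have [x xu] := choice (fun k => proj_through (u k)).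
  have X0x : incident C x [set: 'I_n]%SET X0.
    move=> k _; have := xu k; rewrite /u.
    have [->|ki] := eqVneq k i.
      by move: X0W; rewrite /W mem_center => /eqP->; rewrite mem0v.
    have [->|//] := eqVneq k j.
    by move: X0W; rewrite /W cij mem_center => /eqP->; rewrite mem0v.
  have X0_neq0 : X0 != 0 by rewrite vpick0.
  have [||Y YJ Yx] := inc x (ex_intro2 _ _ X0 X0_neq0 X0x) [set i; j]%SET.
  - by apply/set0Pn; exists i; rewrite !inE eqxx.
  - apply: contraNneq X0_neq0 => cJ0; rewrite -memv0 -cJ0.
    apply/mem_centerI => k; rewrite !inE => /orP[]/eqP->; apply/eqP.
      by rewrite -mem_center.
    by rewrite -mem_center -cij.
  have YW : Y \notin W.
    apply: contraNN YJ => YW; apply/mem_centerI => k.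
    rewrite !inE => /orP[]/eqP->; apply/eqP; rewrite -mem_center //.
    by rewrite -cij.
  (* On J = {i, j}, Y agrees modulo W with multiples of both Y1 and Y2, which
     are independent modulo W. *)
  have near k Z : center (C k) = W -> Z \notin W -> C k *m Z \in val (x k) ->
      k \in [set i; j]%SET -> exists a, Y - a *: Z \in W.
    move=> cW ZW Zx kJ; have CZ : C k *m Z != 0 by rewrite -mem_center cW.
    have := Yx k kJ; rewrite (val_projE CZ Zx) => /vlineP[a CY]; exists a.
    by rewrite -cW mem_center mulmxBr -scalemxAr CY subrr.
  have [a aW] : exists a, Y - a *: Y1 \in W.
    apply: (near i) => //; last by rewrite !inE eqxx.
    by have := xu i; rewrite /u eqxx.
  have [b bW] : exists b, Y - b *: Y2 \in W.
    apply: (near j) => //; last by rewrite !inE eqxx orbT.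
      by apply: contraNN Y2W; apply/subvP; exact: addvSl.
    by have := xu j; rewrite /u eqxx eq_sym (negPf ij).
  have b0 : b != 0.
    by apply: contraNneq YW => b0; move: bW; rewrite b0 scale0r subr0.
  have YU : Y \in (W + <[Y1]>)%VS.
    by rewrite -(subrK (a *: Y1) Y) memv_add // memvZ // memv_line.
  case/negP: Y2W; have -> : Y2 = b^-1 *: (Y - (Y - b *: Y2)).
    by rewrite subKr scalerA mulVf // scale1r.
  by rewrite memvZ // memvB // (subvP (addvSl _ _)).
apply/(multiview_eq_incident C n_gt0) => x _ J /set0Pn[j jJ] cJ.
have [Y YE] := camera_surj j (coords (x j)); exists Y.
  by apply/notin_centerI; exists j; rewrite // YE coords_neq0.
move=> i iJ; have [->|ij] := eqVneq i j; first by rewrite YE coords_mem.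
case: (posnP N) => [N0|N_gt0].
  have -> : val (x i) = fullv; last exact: memvf.
  apply/eqP; rewrite eqEdim subvf dimvf dim_matrix mulr1 (eqP (valP (x i))).
  by rewrite N0.
have subJ k : k \in J -> (centerI C J <= center (C k))%VS.
  by move=> kJ; apply: bigcapv_inf kJ _.
have eqJ k : k \in J -> centerI C J = center (C k).
  move=> kJ; apply/eqP; rewrite eqEdim subJ // dim_center.
  by rewrite lt0n dimv_eq0.
by have := dist N_gt0 i j ij; rewrite -(eqJ i iJ) -(eqJ j jJ) eqxx.
Qed.

End Conical.

(** * Cameras to the projective line *)

Section ProjectiveLine.
Variables (K : numFieldType) (n N : nat) (C : arrangement K n N 1).
Hypotheses (n_gt0 : (0 < n)%N) (fC : forall i, full_rank (C i)).

Lemma tilde_mul (u v : 'cV[K]_2) :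
  ((tilde u)^T *m v) 0 0 = u ord_max 0 * v 0 0 - u 0 0 * v ord_max 0.
Proof.
have e0 : 0 = lshift 1 0 :> 'I_(1 + 1) by exact/val_inj.
have e1 : ord_max = rshift 1 0 :> 'I_(1 + 1) by exact/val_inj.
have tE : tilde u =
    col_mx (dsubmx (u : 'cV_(1 + 1))) (- usubmx (u : 'cV_(1 + 1))).
  rewrite /tilde -[u in _ *m u](@vsubmxK _ 1 1) mul_block_col.
  by rewrite !mul0mx mulNmx !mul1mx addr0 add0r.
have t0 : tilde u 0 0 = u ord_max 0.
  rewrite [X in tilde u X]e0 tE.
  by rewrite (@col_mxEu _ 1 1 1) mxE e1.
have t1 : tilde u ord_max 0 = - u 0 0.
  rewrite [X in tilde u X]e1 tE (@col_mxEd _ 1 1 1) !mxE.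
  by rewrite [X in _ = - u X _]e0.
have -> : ((tilde u)^T *m v) 0 0 = \sum_k tilde u k 0 * v k 0.
  by rewrite mxE; apply: eq_bigr => k _; rewrite [_^T _ _]mxE.
rewrite big_ord_recl big_ord1 t0 -[lift _ _](_ : ord_max = _) ?t1 ?mulNr //.
exact/val_inj.
Qed.

Lemma mem_proj_tilde (x : proj K 1) (v : 'cV_2) :
  (v \in val x) = ((tilde (coords x))^T *m v == 0).
Proof.
have := coords_neq0 x; move: (coords x) (@mem_projP K 1 x v) => u uP u0.
have -> : ((tilde u)^T *m v == 0) = (((tilde u)^T *m v) 0 0 == 0).
  apply/eqP/eqP => [->|e]; first by rewrite mxE.
  by apply/matrixP => k l; rewrite !ord1 e mxE.
rewrite tilde_mul subr_eq0; apply/uP/eqP => [[a ->]|e].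
  by rewrite !mxE mulrCA [RHS]mulrCA [u 0 0 * _]mulrC.
have vE a : v 0 0 = a * u 0 0 -> v ord_max 0 = a * u ord_max 0 -> v = a *: u.
  move=> v0 v1; apply/matrixP => k l; rewrite ord1 mxE.
  have [->//|->//] : k = 0 \/ k = ord_max.
  by case: k => [[|[|//]] kP]; [left|right]; apply/val_inj.
have [u00|u00] := eqVneq (u 0 0) 0; last first.
  exists (v 0 0 / u 0 0); apply: vE; first by rewrite divfK.
  by rewrite mulrAC -[v 0 0 * _]mulrC e mulrAC divff ?mul1r.
have u1 : u ord_max 0 != 0.
  apply: contra_neq u0 => u1; apply/matrixP => k l; rewrite ord1 [RHS]mxE.
  have [->//|->//] : k = 0 \/ k = ord_max.
  by case: k => [[|[|//]] kP]; [left|right]; apply/val_inj.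
exists (v ord_max 0 / u ord_max 0); apply: vE; last by rewrite divfK.
move/eqP: e; rewrite u00 mul0r mulf_eq0 (negPf u1) => /eqP->.
by rewrite mulr0.
Qed.

Lemma proj_annihilated (w : 'rV[K]_2) :
  exists x : proj K 1, forall v, v \in val x -> w *m v = 0.
Proof.
have [|v v0 wv] := row_fullPn w _.
  by rewrite /row_full neq_ltn ltnS rank_leq_row.
have [x xE] := proj_line v0; exists x => u; rewrite xE => /vlineP[a ->].
by rewrite -scalemxAr wv scaler0.
Qed.

(** A row vector Y^T in the left kernel of the matrix is a vector Y incident to
    x: pairing C_i Y with the rotated x_i tests proportionality. *)
Lemma rank_tildeP (x : 'I_n -> proj K 1) :
  (\rank (cols_mx (fun i => (C i)^T *m tilde (coords (x i)))) <= N)%N <->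
  (exists2 Y, Y != 0 & incident C x [set: 'I_n]%SET Y).
Proof.
set A := cols_mx _.
have mulA (u : 'rV_N.+1) i :
    (u *m A) 0 i = ((tilde (coords (x i)))^T *m (C i *m u^T)) 0 0.
  have -> : (tilde (coords (x i)))^T *m (C i *m u^T) =
      (u *m ((C i)^T *m tilde (coords (x i))))^T.
    by rewrite !trmx_mul trmxK mulmxA.
  by rewrite [RHS]mxE ![in LHS]mxE [RHS]mxE; apply: eq_bigr => k _; rewrite mxE.
have memE (u : 'rV_N.+1) i : ((u *m A) 0 i == 0) = (C i *m u^T \in val (x i)).
  rewrite mem_proj_tilde mulA; apply/eqP/eqP => [e|->]; last by rewrite mxE.
  by apply/matrixP => k l; rewrite !ord1 e mxE.
have -> : (\rank A <= N)%N = (kermx A != 0).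
  by rewrite kermx_eq0 /row_free eqn_leq rank_leq_row -ltnNge ltnS.
split=> [/rowV0Pn[u /sub_kermxP uA u0]|[Y Y0 Yx]].
  exists u^T; rewrite ?trmx_eq0 // => i _.
  by rewrite -memE uA mxE.
apply/rowV0Pn; exists Y^T; rewrite ?trmx_eq0 //; apply/sub_kermxP.
apply/matrixP => k i; rewrite ord1 [RHS]mxE; apply/eqP.
by rewrite memE trmxK Yx // finset.in_setT.
Qed.

Lemma projdim_centerI_le (J : {set 'I_n}) :
  (N%:Z - #|J|%:Z - 1 >= projdim (centerI C J)) = (#|J| < \rank (row_sum C J))%N.
Proof.
rewrite /projdim; move: (\dim _) (\rank _) (dim_centerI C J) => d r dE.
by rewrite lerD2r lerBrDr -PoszD lez_nat -ltnS -dE ltn_add2l.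
Qed.

(** Incidence on J is expressed by #|J| linear forms, too few to span all the
    forms that vanish on c_J. *)
Lemma exists_incident_of_rank (x : 'I_n -> proj K 1) (J : {set 'I_n}) :
  (#|J| < \rank (row_sum C J))%N ->
  exists2 Y, Y \notin centerI C J & incident C x J Y.
Proof.
pose w i := (tilde (coords (x i)))^T *m C i.
pose W := (\sum_(i in J) <<w i>>)%MS.
move=> ltJ; have : ~~ (row_sum C J <= W)%MS.
  apply: contraL ltJ => /mxrankS SW; rewrite -leqNgt (leq_trans SW) //.
  rewrite /W -sum1_card; elim/big_ind2: _ => [|A a B b Aa Bb|i _].
  - by rewrite mxrank0.
  - exact: leq_trans (mxrank_adds_leqif _ _) (leq_add Aa Bb).
  - by rewrite mxrank_gen rank_leq_row.
rewrite submxE => nz.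
have [k nzk] : exists k, row_sum C J *m col k (cokermx W) != 0.
  apply/existsP; apply: contraNT nz => /existsPn z; apply/eqP/matrixP => a k.
  have /negPn/eqP := z k; rewrite colE mulmxA -colE.
  by move=> /matrixP/(_ a 0); rewrite !mxE.
exists (col k (cokermx W)).
  by rewrite (mem_centerI_row_sum _ (eqmx_refl _)).
move=> i iJ; rewrite mem_proj_tilde mulmxA -/(w i).
have /submxP[D ->] : (w i <= W)%MS by rewrite (sumsmx_sup i) ?genmxE.
by rewrite -mulmxA colE [W *m _]mulmxA mulmx_coker mul0mx mulmx0.
Qed.

(** The family of row spaces satisfies Rado's condition on I itself because
    removing one index already leaves rank at least #|I|, except for a singleton
    I, where the camera is nonzero.  An independent transversal then has #|I|
    vectors, enough to span the sum of the row spaces. *)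
Lemma exists_spanning_lines (I : {set 'I_n}) : I != finset.set0 ->
  (\rank (row_sum C I) <= #|I|)%N ->
  (forall J : {set 'I_n}, J != finset.set0 -> J \proper I ->
     #|J| < \rank (row_sum C J))%N ->
  exists w : 'I_n -> 'rV_2,
    (row_sum C I <= \sum_(i in I) <<w i *m C i>>)%MS.
Proof.
move=> I0 leI minI.
have geI : (#|I| <= \rank (row_sum C I))%N.
  have /set0Pn[i iI] := I0; rewrite (cardsD1 i) iI add1n.
  have [J0|J0] := eqVneq (I :\ i) finset.set0.
    rewrite J0 cards0 lt0n mxrank_eq0 -submx0.
    apply: contraTN (fC i) => S0; rewrite /full_rank.
    have /eqP-> : C i == 0.
      rewrite -submx0; apply: submx_trans S0.
      by rewrite (sumsmx_sup i) ?genmxE.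
    by rewrite mxrank0 eq_sym -lt0n leq_min.
  apply: leq_trans (minI _ J0 _) _; first exact: properD1.
  apply: mxrankS; apply/sumsmx_subP => j; rewrite inE => /andP[_ jI].
  by rewrite (sumsmx_sup j).
have [|v [vC rkv]] := rado (V := fun i => <<C i>>%MS) (A := I) (B := 0).
  move=> J JI; rewrite mxrank0 addn0 adds0mx.
  have [->|J0] := eqVneq J finset.set0; first by rewrite cards0.
  have [->//|JI'] := eqVneq J I.
  by apply/ltnW/minI; rewrite // finset.properEneq JI' JI.
exists (fun i => v i *m pinvmx (C i)).
have -> : (\sum_(i in I) <<v i *m pinvmx (C i) *m C i>> =
           \sum_(i in I) <<v i>>)%MS.
  by apply: eq_bigr => i iI; rewrite mulmxKpV //; have := vC i iI; rewrite genmxE.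
have sub : (\sum_(i in I) <<v i>> <= row_sum C I)%MS.
  by apply: sumsmxS => i iI; rewrite genmxE vC.
rewrite -(mxrank_leqif_sup sub) eqn_leq mxrankS //=.
by move: rkv; rewrite mxrank0 addn0 adds0mx => ->.
Qed.

(** For necessity, the x_i with i in a smallest violating I are chosen so that
    incidence on I forces Y into c_I, while the other x_i are the images of
    a vector X0 of c_I, which is thus incident to x on all indices. *)
Lemma multiview_projective_line :
  multiview C = [set x |
    (\rank (cols_mx (fun i => (C i)^T *m tilde (coords (x i)))) <= N)%N] <->
  (forall I : {set 'I_n}, (1 <= #|I|)%N -> centerI C I != 0%VS ->
     N%:Z - #|I|%:Z - 1 >= projdim (centerI C I)).
Proof.
have -> : [set x |
    (\rank (cols_mx (fun i => (C i)^T *m tilde (coords (x i)))) <= N)%N] =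
    [set x | exists2 Y, Y != 0 & incident C x [set: 'I_n]%SET Y].
  by apply/seteqP; split=> x /rank_tildeP.
split=> [/(multiview_eq_incident C n_gt0) inc|codim]; last first.
  apply/(multiview_eq_incident C n_gt0) => x _ J J0 cJ.
  apply: exists_incident_of_rank; rewrite -projdim_centerI_le.
  by apply: codim; rewrite // card_gt0.
move=> I1 I1_gt0 cI1; rewrite projdim_centerI_le ltnNge; apply/negP => leI1.
(* Centers grow when indices are removed, so that c_J stays nonzero for the
   proper subsets J of a violating set. *)
pose bad (I : {set 'I_n}) :=
  [&& I != finset.set0, centerI C I != 0%VS & (\rank (row_sum C I) <= #|I|)%N].
have badI1 : bad I1 by rewrite /bad -card_gt0 I1_gt0 cI1.
case: (arg_minnP (fun I : {set 'I_n} => #|I|) badI1) => I /and3P[I0 cI leI] minI.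
have [|w wI] := exists_spanning_lines I0 leI.
  move=> J J0 JI; rewrite ltnNge; apply: contraTN (proper_card JI) => leJ.
  rewrite -leqNgt; apply: minI; rewrite /bad J0 leJ andbT /=.
  apply: contraNneq cI => cJ; rewrite -subv0 -cJ; apply/subvP => Y.
  move=> /mem_centerI CY; apply/mem_centerI => i iJ; apply: CY.
  exact: (fintype.subsetP (proper_sub JI)).
pose X0 := vpick (centerI C I).
have X0I : X0 \in centerI C I by exact: memv_pick.
have /choice[x xP] (i : 'I_n) : exists y : proj K 1,
    if i \in I then forall v, v \in val y -> w i *m v = 0
    else C i *m X0 \in val y.
  by case: (i \in I); [exact: proj_annihilated|exact: proj_through].
have X0x : incident C x [set: 'I_n]%SET X0.
  move=> i _; have := xP i; case: (boolP (i \in I)) => // iI _.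
  by move/mem_centerI: X0I => -> //; rewrite mem0v.
have X0_neq0 : X0 != 0 by rewrite vpick0.
have [Y YI Yx] := inc x (ex_intro2 _ _ X0 X0_neq0 X0x) I I0 cI.
case/negP: YI; rewrite (mem_centerI_row_sum _ (eqmx_refl _)).
case/submxP: wI => D ->; rewrite -mulmxA.
have -> : (\sum_(i in I) <<w i *m C i>>)%MS *m Y = 0; last by rewrite mulmx0.
have /sub_sumsmxP[u ->] := submx_refl (\sum_(i in I) <<w i *m C i>>)%MS.
rewrite mulmx_suml big1 // => i iI.
have /submxP[E ->] : (<<w i *m C i>> <= w i *m C i)%MS by rewrite genmxE.
have := xP i; rewrite iI => /(_ _ (Yx i iI)) wCY.
by rewrite -!mulmxA wCY !mulmx0.
Qed.

End ProjectiveLine.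

(** * The three rank descriptions *)

Unset Implicit Arguments.

Theorem theorem4p3 (R : realType) (n : nat) (hn : (1 <= n)%N) :
  [/\ (forall (N : nat) (C : arrangement R[i] n N N),
         (forall i, full_rank (C i)) ->
         multiview C =
           [set x | (\rank (cols_mx (fun i => invmx (C i) *m coords (x i)))
                     <= 1)%N]),
      (forall (N : nat) (C : arrangement R[i] n N N.-1), (1 <= N)%N ->
         (forall i, full_rank (C i)) ->
         (multiview C = [set x | (\rank (multiview_mx C x) <= N + n)%N] <->
          (* for N = 1 the target is the point (P^0)^n: both sides of the
             equality are that point, whatever the centers are *)
          ((1 < N)%N -> forall i j : 'I_n, i != j ->
             center (C i) != center (C j))))
    & (forall (N : nat) (C : arrangement R[i] n N 1),
         (forall i, full_rank (C i)) ->
         (multiview C =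
            [set x | (\rank (cols_mx (fun i =>
                                (C i)^T *m tilde (coords (x i)))) <= N)%N] <->
          (forall I : {set 'I_n}, (1 <= #|I|)%N -> centerI C I != 0%VS ->
             N%:Z - #|I|%:Z - 1 >= projdim (centerI C I))))].
Proof.
split=> [N C fC|[//|N] C _ fC|N C fC].
- exact: multiview_homographies.
- exact: multiview_conical.
- exact: multiview_projective_line.
Qed.
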